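(* Let $w\in\{\mathtt a,\mathtt b\}^n$. Then the cardinality of the $\sim_2$-class of $w$ in $\{\mathtt a,\mathtt b\}^n$ is $$\#[w]_{\sim_2}=[q^{\binom{w}{\mathtt{ab}}}]\binom{n}{|w|_{\mathtt a}}_{\!q}.$$
   Context: $|w|_{\mathtt a}$ is the number of letters $\mathtt a$ in $w$ and $\binom{w}{\mathtt{ab}}$ the number of occurrences of $\mathtt{ab}$ as a scattered subword of $w$. For $u,w\in\{\mathtt a,\mathtt b\}^n$, $u\sim_2w$ iff $|u|_{\mathtt a}=|w|_{\mathtt a}$ and $\binom{u}{\mathtt{ab}}=\binom{w}{\mathtt{ab}}$. The Gaussian binomial coefficient is the polynomial $\binom{c}{d}_q=\prod_{i=1}^d\frac{1-q^{c-d+i}}{1-q^i}$ for $0\le d\le c$; $[q^k]f$ is the coefficient of $q^k$ in $f$. *)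

(* Defs.v *)
From HB Require Import structures.
From mathcomp Require Import all_boot all_order all_algebra ring.
Set Implicit Arguments.
Unset Strict Implicit.
Unset Printing Implicit Defensive.
Import GRing.Theory.
Local Open Scope ring_scope.

(* The alphabet {a, b} is encoded by bool; a word of length n is an
   n.-tuple bool. *)
Definition letter_a : bool := true.
Definition letter_b : bool := false.

(* The binomial coefficient of words (w choose u): an occurrence of u as a
   scattered subword of w is a choice of positions of w, here a mask of
   length n, whose letters spell u from left to right. *)
Definition word_binom (n : nat) (w : n.-tuple bool) (u : seq bool) : nat :=
  #|[set m : n.-tuple bool | mask m w == u]|.

Definition sim2 (n : nat) : rel (n.-tuple bool) := fun u w =>
  (count_mem letter_a u == count_mem letter_a w)
  && (word_binom u [:: letter_a; letter_b] == word_binom w [:: letter_a; letter_b]).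

Definition sim2_class (n : nat) (w : n.-tuple bool) : {set n.-tuple bool} :=
  [set u | sim2 u w].

Definition gauss_num (c d : nat) : {poly rat} :=
  \prod_(1 <= i < d.+1) (1 - 'X^(c - d + i)).

Definition gauss_den (d : nat) : {poly rat} :=
  \prod_(1 <= i < d.+1) (1 - 'X^i).

(* Meaningful only for d <= c, where the Euclidean quotient is exact
   (gauss_binomE). *)
Definition gauss_binom (c d : nat) : {poly rat} :=
  gauss_num c d %/ gauss_den d.

Lemma gauss_den_neq0 (d : nat) : gauss_den d != 0.
Proof.
rewrite /gauss_den prodf_seq_neq0; apply/allP => i.
rewrite mem_index_iota => /andP[i_gt0 _] /=.
by rewrite -oppr_eq0 opprB -size_poly_gt0 size_XnsubC.
Qed.

Lemma gauss_den_dvd_num (c d : nat) :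
  (d <= c)%N -> gauss_den d %| gauss_num c d.
Proof.
move=> le_dc; rewrite /gauss_num; move: (c - d)%N => m {c le_dc}.
elim: d m => [|d IHd] m; first by rewrite /gauss_den !big_geq.
elim: m => [|m IHm]; first by rewrite /gauss_den dvdpp.
have -> : \prod_(1 <= i < d.+2) (1 - 'X^(m.+1 + i)) =
    \prod_(1 <= i < d.+2) (1 - 'X^(m + i)) +
    'X^(m.+1) * (\prod_(1 <= i < d.+1) (1 - 'X^(m.+1 + i)) * (1 - 'X^(d.+1)))
    :> {poly rat}.
  rewrite big_nat_recr //= [in X in _ = X + _]big_nat_recl //=.
  under [in X in _ = X + _]eq_bigr do rewrite addnS -addSn.
  rewrite addn1 exprD; set P := \prod_(_ <= i < _) _; by ring.
rewrite dvdp_add // dvdp_mull // /gauss_den big_nat_recr //=.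
by rewrite dvdp_mul2r ?IHd // -oppr_eq0 opprB -size_poly_gt0 size_XnsubC.
Qed.

Local Notation "x %:F" := (FracField.tofrac x).

Lemma gauss_binomE (c d : nat) : (d <= c)%N ->
  (gauss_binom c d)%:F =
  \prod_(1 <= i < d.+1) ((1 - 'X^(c - d + i))%:F / (1 - 'X^i)%:F)
  :> {fraction {poly rat}}.
Proof.
move=> le_dc; rewrite big_split /= prodfV -!rmorph_prod /=.
apply: canRL (mulfK _) _; first by rewrite tofrac_eq0 gauss_den_neq0.
by rewrite -rmorphM /= divpK // gauss_den_dvd_num.
Qed.

(* Main.v *)
Require Import Defs.
From HB Require Import structures.
From mathcomp Require Import all_boot all_order all_algebra.
From mathcomp Require Import ring.
Import GRing.Theory.
Local Open Scope ring_scope.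

(** Let [G n d] be the sum of [q^(w choose ab)] over the words [w] of length [n]
    with [d] letters a.  Deleting the first letter of a word gives
    [G (n+1) (d+1) = q^(n-d) G n d + G n (d+1)], since a leading a makes a new
    occurrence of ab with each of the [n - d] letters b that follow it.  This is
    a Pascal recurrence of the Gaussian binomial coefficients, so the two
    polynomials agree; then compare the coefficients of [q^k]. *)

(** Used both for sums over masks and for sums over words: each recursion below splits off the first
    entry. *)
Lemma big_tupleS (R : Type) (idx : R) (op : Monoid.com_law idx) (T : finType)
    (n : nat) (P : pred (n.+1.-tuple T)) (F : n.+1.-tuple T -> R) :
  \big[op/idx]_(t | P t) F t =
  \big[op/idx]_(x : T)
    \big[op/idx]_(t : n.-tuple T | P [tuple of x :: t]) F [tuple of x :: t].
Proof.
rewrite pair_big_dep /=.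
rewrite (reindex (fun p : T * n.-tuple T => [tuple of p.1 :: p.2])) //=.
exists (fun t : n.+1.-tuple T => (thead t, [tuple of behead t])) => [[x t] _|t _].
  by congr pair; apply/val_inj.
by rewrite /= -tuple_eta.
Qed.

Lemma word_binomE (n : nat) (w : n.-tuple bool) (u : seq bool) :
  word_binom w u = (\sum_(m : n.-tuple bool) (mask m w == u))%N.
Proof. by rewrite /word_binom -sum1dep_card big_mkcond. Qed.

Lemma word_binom_tuple0 (w : 0.-tuple bool) (u : seq bool) :
  word_binom w u = (u == [::]).
Proof.
rewrite word_binomE (big_pred1 [tuple]) => [|m]; last exact/esym/eqP/tuple0.
by rewrite (tuple0 w) eq_sym.
Qed.

Lemma word_binom_nil (n : nat) (w : n.-tuple bool) : word_binom w [::] = 1%N.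
Proof.
elim: n w => [|n IHn] w; first by rewrite word_binom_tuple0.
case/tupleP: w => x w; rewrite word_binomE big_tupleS big_bool /=.
(* A mask that starts with [true] selects a letter, so it cannot spell the empty word. *)
by rewrite big1 // add0n -word_binomE IHn.
Qed.

(** A mask either selects [x], which must then equal [y] while the rest spells [u], or skips [x]. *)
Lemma word_binom_cons (n : nat) (x y : bool) (w : n.-tuple bool) (u : seq bool) :
  word_binom [tuple of x :: w] (y :: u) =
  ((x == y) * word_binom w u + word_binom w (y :: u))%N.
Proof.
rewrite !word_binomE big_tupleS big_bool /= big_distrr /=; congr addn.
by apply: eq_bigr => m _; rewrite eqseq_cons mulnb.
Qed.

Lemma word_binom_letter (n : nat) (w : n.-tuple bool) (y : bool) :
  word_binom w [:: y] = count_mem y w.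
Proof.
elim: n w => [|n IHn] w; first by rewrite word_binom_tuple0 (tuple0 w).
by case/tupleP: w => x w; rewrite word_binom_cons word_binom_nil muln1 IHn.
Qed.

Lemma count_letter_b (n : nat) (w : n.-tuple bool) :
  count_mem letter_b w = (n - count_mem letter_a w)%N.
Proof.
apply/esym/(canLR (addKn _)); rewrite -[LHS](size_tuple w).
rewrite -(count_predC (pred1 letter_a)); congr addn.
by apply: eq_count; case.
Qed.

Definition word_gf (n d : nat) : {poly rat} :=
  \sum_(u : n.-tuple bool | count_mem letter_a u == d)
    'X^(word_binom u [:: letter_a; letter_b]).

Lemma word_gf_gt (n d : nat) : (n < d)%N -> word_gf n d = 0.
Proof.
move=> lt_nd; rewrite /word_gf big_pred0 // => u; apply/negbTE.
by rewrite neq_ltn (leq_ltn_trans (count_size _ _)) // size_tuple.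
Qed.

Lemma word_gf00 : word_gf 0 0 = 1.
Proof.
rewrite /word_gf (big_pred1 [tuple]) => [|u]; last by rewrite (tuple0 u); exact/esym/eqP.
by rewrite word_binom_tuple0.
Qed.

Lemma word_gfS0 (n : nat) : word_gf n.+1 0 = word_gf n 0.
Proof.
rewrite /word_gf big_tupleS big_bool /= big_pred0 ?add0r //.
by apply: eq_bigr => u _; rewrite word_binom_cons.
Qed.

Lemma word_gfSS (n d : nat) :
  word_gf n.+1 d.+1 = 'X^(n - d) * word_gf n d + word_gf n d.+1.
Proof.
rewrite /word_gf big_tupleS big_bool /= big_distrr /=; congr (_ + _).
  apply: eq_big => [u|u]; first by rewrite add1n eqSS.
  rewrite add1n eqSS => /eqP <-.
  by rewrite word_binom_cons eqxx mul1n word_binom_letter count_letter_b exprD.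
by apply: eq_bigr => u _; rewrite word_binom_cons.
Qed.

Lemma gauss_denS (d : nat) : gauss_den d.+1 = gauss_den d * (1 - 'X^(d.+1)).
Proof. by rewrite /gauss_den big_nat_recr. Qed.

Lemma gauss_num_diag (n : nat) : gauss_num n n = gauss_den n.
Proof. by rewrite /gauss_num subnn. Qed.

(** This is the Pascal recurrence cleared of denominators. All three terms share the factor
    [gauss_num n.+1 d], and what remains is [1 - 'X^(n.+1) = 'X^(n - d) * (1 - 'X^(d.+1)) + (1 -
    'X^(n - d))]. *)
Lemma gauss_numSS (n d : nat) : (d < n)%N ->
  gauss_num n.+1 d.+1 =
  'X^(n - d) * (gauss_num n d * (1 - 'X^(d.+1))) + gauss_num n d.+1.
Proof.
move=> lt_dn; rewrite /gauss_num subSS -(subnSK lt_dn).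
move: (n - d.+1)%N => m {lt_dn}.
(* Splitting off the last factor on the left and the first one on the right leaves the same product
   [P]. *)
rewrite big_nat_recr //= [in X in _ = _ + X]big_nat_recl //=.
under [in X in _ = _ + X]eq_bigr do rewrite addnS -addSn.
by rewrite addn1 exprD; set P := \prod_(_ <= i < _) _; ring.
Qed.

Lemma word_gfM_den (n d : nat) : (d <= n)%N ->
  word_gf n d * gauss_den d = gauss_num n d.
Proof.
elim: n d => [|n IHn] [|d] //.
- by rewrite word_gf00 mul1r gauss_num_diag.
- by move=> _; rewrite word_gfS0 IHn // /gauss_num !big_geq.
rewrite ltnS => le_dn; rewrite word_gfSS mulrDl gauss_denS -mulrA (mulrA (word_gf n d)).
rewrite IHn //; have [lt_dn|le_nd] := ltnP d n.
  by rewrite -gauss_denS IHn // gauss_numSS.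
(* The diagonal is separate: [word_gf n n.+1] vanishes, but truncated subtraction makes
   [gauss_num n n.+1] nonzero. *)
have -> : d = n by apply/eqP; rewrite eqn_leq le_dn.
by rewrite word_gf_gt // mul0r addr0 subnn mul1r !gauss_num_diag gauss_denS.
Qed.

Lemma gauss_binom_word_gf (n d : nat) : (d <= n)%N ->
  gauss_binom n d = word_gf n d.
Proof.
by move=> le_dn; rewrite /gauss_binom -word_gfM_den // mulpK // gauss_den_neq0.
Qed.

Theorem corollary5 (n : nat) (w : n.-tuple bool) :
  #|sim2_class w|%:R =
  (gauss_binom n (count_mem letter_a w))`_(word_binom w [:: letter_a; letter_b]) :> rat.
Proof.
have le_an : (count_mem letter_a w <= n)%N by have := count_size (pred1 letter_a) w; rewrite size_tuple.
rewrite gauss_binom_word_gf // /word_gf coef_sum /sim2_class -sum1dep_card natr_sum.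
(* The condition on ab becomes a 0/1 summand, which is the coefficient of a monomial. *)
rewrite /sim2 big_mkcondr /=; apply: eq_bigr => u _.
by rewrite coefXn eq_sym; case: eqP.
Qed.
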